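(* Let $\mathsf G$ be a finite group, $\mathcal M$ a closed connected oriented surface of genus $n\ge1$, and $\Lambda$ a finite connected directed graph cellularly embedded in $\mathcal M$. Let $H_{\mathsf m}=\sum_vh_v$ be a local $\mathsf G$-symmetric Hamiltonian and assume that for every $\gamma$ (labels of flat connections, as in the context) the twisted Hamiltonian $H_{\mathsf m}^{\phi^\gamma}=\sum_vh_v^{\phi^\gamma}$ has a unique (normalized) ground state $|\lambda_0^\gamma\rangle$, with the same energy $\lambda_0$ for all $\gamma$. For $\gamma,\gamma'$ drawn from a fixed set of representatives of the conjugacy classes in $\mathcal I_{\mathcal M}$, let $$M_{[\gamma'],[\gamma]}=\langle\lambda_0^{\gamma'}|G_{\phi^{\gamma'}}^\dagger G_{\phi^\gamma}|\lambda_0^\gamma\rangle .$$ Then the matrix $M$ is diagonal, it is invariant under a change of the set of representatives, and $M_{[\gamma],[\gamma]}=0$ if and only if $|\lambda_0^\gamma\rangle$ transforms as a nontrivial (one-dimensional) representation under the physical symmetry action $g\mapsto\bigotimes_vU_v(g)$ of the centralizer $\mathsf C(\gamma)$.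
   Context: Each vertex $v$ carries a finite-dimensional Hilbert space $\mathbb H_v$ with a unitary representation $U_v$ of $\mathsf G$, and each edge $e$ carries $\mathbb C[\mathsf G]$ with orthonormal basis $\{|g\rangle\}$. Matter space $\mathbb H_{\mathsf m}=\bigotimes_v\mathbb H_v$. Edge $e$ points from $v_e^+$ to $v_e^-$. A $\mathsf G$-connection is an assignment $\phi:e\mapsto\phi_e\in\mathsf G$; for an oriented path $p$ traversing edges $e_1,\dots,e_k$ in this order, $\phi_p=\phi_{e_k}^{\sigma_k}\cdots\phi_{e_1}^{\sigma_1}$ with $\sigma_i=+1$ if $e_i$ is traversed along its direction and $-1$ otherwise. $\phi$ is flat if $\phi_p=1$ for every closed path contractible in $\mathcal M$. Paths: fix simple closed oriented paths $p_x^1,p_y^1,\dots,p_x^n,p_y^n$ in the dual graph, spanning the inequivalent noncontractible loops of $\mathcal M$ (cutting $\mathcal M$ along all of them gives a disc), such that $p_x^i$ and $p_y^i$ intersect exactly once (transversally, in a face), $p_y^i$ and $p_x^{i+1}$ intersect exactly once, all other pairs are disjoint, and each edge of $\Lambda$ is crossed at most once in total. A label is $\gamma=\{(x_i,y_i)\}_{i=1}^n$ with $x_i,y_i\in\mathsf G$, $x_iy_i=y_ix_i$ and $y_ix_{i+1}=x_{i+1}y_i$; $\mathcal I_{\mathcal M}$ is the set of classes $[\gamma]$ of such labels under simultaneous conjugation $(x_i,y_i)\mapsto(hx_ih^{-1},hy_ih^{-1})$. $\mathsf C(\gamma)$ is the subgroup of elements commuting with all $x_i,y_i$. The connection $\phi^\gamma$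 is defined by $\phi^\gamma_e=x_i^{\sigma}$ if $p_x^i$ crosses $e$, $\phi^\gamma_e=y_i^{\sigma}$ if $p_y^i$ crosses $e$, with $\sigma=+1$ for a right-handed and $-1$ for a left-handed crossing, and $\phi^\gamma_e=1$ otherwise. It is flat. Local symmetric Hamiltonian: each Hermitian $h_v$ acts on the vertices of a connected subgraph $\Gamma_v$ (containing all edges between its vertices) all of whose closed paths are contractible in $\mathcal M$, and commutes with $\bigotimes_{w}U_w(g)$ for all $g$. Its twist by a flat connection $\phi$ is $h_v^\phi=\big(\bigotimes_{w\in\Gamma_v}U_w(\phi_{p_w})\big)h_v\big(\bigotimes_{w\in\Gamma_v}U_w(\phi_{p_w})\big)^\dagger$, where $p_w$ is any path in $\Gamma_v$ from a fixed base vertex of $\Gamma_v$ to $w$ (the choices do not matter). Twisted gauging map: for $|\psi\rangle\in\mathbb H_{\mathsf m}$, $$G_\phi|\psi\rangle=\frac1{|\mathsf G|^{|\Lambda_v|}}\sum_{(g_v)}\Big(\bigotimes_vU_v(g_v)\Big)|\psi\rangle\otimes\bigotimes_e|g_{v_e^-}\phi_eg_{v_e^+}^{-1}\rangle_e ,$$ the sum being over all assignments of group elements to vertices and $|\Lambda_v|$ the number of vertices. *)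

(* Defs.v *)
From HB Require Import structures.
From mathcomp Require Export all_boot all_order all_algebra all_fingroup.
From mathcomp Require Export mxrepresentation sesquilinear spectral.
From mathcomp Require Export reals complex mxtens.

Set Implicit Arguments.
Unset Strict Implicit.
Unset Printing Implicit Defensive.

Import Order.TTheory GRing.Theory Num.Theory.
Local Open Scope ring_scope.
Local Open Scope sesquilinear_scope.

(* Directed graphs cellularly embedded in a closed oriented surface.

   The embedding is encoded by its rotation system. A dart (e, b) is the edge
   e traversed along its direction if b = true, against it if b = false. [rot]
   sends a dart d to the next dart, counterclockwise, among the darts leaving
   the same vertex. The 2-cells of the surface are glued along the orbits of
   [face_next], so the closed oriented surface is determined by this data, and
   every cellular embedding arises this way. Loops and multiple edges are
   allowed. [tail e] is v_e^+ and [head e] is v_e^-. *)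

Record embedded_graph := EmbeddedGraph {
  vertex : finType;
  edge : finType;
  tail : edge -> vertex;
  head : edge -> vertex;
  rot : {perm edge * bool};
  rotP : forall d d' : edge * bool,
    (d' \in porbit rot d) =
    ((if d.2 then tail d.1 else head d.1) ==
     (if d'.2 then tail d'.1 else head d'.1))
}.

Section Graph.
Variable L : embedded_graph.

Definition dart : finType := (edge L * bool)%type.

Definition src (d : dart) : vertex L := if d.2 then tail d.1 else head d.1.
Definition tgt (d : dart) : vertex L := if d.2 then head d.1 else tail d.1.
Definition flip (d : dart) : dart := (d.1, ~~ d.2).

(* The dart following d on the boundary of the face lying to the left of d. *)
Definition face_next (d : dart) : dart := ((rot L)^-1)%g (flip d).

(* The face to the left of d, as the set of darts with that face on the left. *)
Definition face (d : dart) : {set dart} := [set d' | fconnect face_next d d'].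

Definition faces : {set {set dart}} := [set face d | d : dart].

Fixpoint walk (u : vertex L) (p : seq dart) (v : vertex L) : bool :=
  if p is d :: p' then (src d == u) && walk (tgt d) p' v else u == v.

Definition connected_graph : Prop :=
  forall u v : vertex L, exists p, walk u p v.

(* Euler's formula V - E + F = 2 - 2n. *)
Definition has_genus (n : nat) : Prop :=
  (#|vertex L| + #|faces| + n.*2 = #|edge L| + 2)%N.

(* Combinatorial homotopy, rel endpoints, of walks from u to v: generated by
   removing backtracks and boundary circuits of faces. *)
Inductive homotopic (u v : vertex L) : seq dart -> seq dart -> Prop :=
| homotopic_refl p : homotopic u v p p
| homotopic_sym p q : homotopic u v p q -> homotopic u v q p
| homotopic_trans p q r :
    homotopic u v p q -> homotopic u v q r -> homotopic u v p r
| homotopic_backtrack p d q : walk u (p ++ [:: d; flip d] ++ q) v ->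
    homotopic u v (p ++ [:: d; flip d] ++ q) (p ++ q)
| homotopic_face p d q : walk u (p ++ fingraph.orbit face_next d ++ q) v ->
    homotopic u v (p ++ fingraph.orbit face_next d ++ q) (p ++ q).

Definition contractible (u : vertex L) (p : seq dart) : Prop :=
  homotopic u u p [::].

(* Walks in the subgraph induced on the vertex set S. *)
Definition walk_in (S : {set vertex L}) u p v : bool :=
  [&& u \in S, walk u p v & all (fun d => tgt d \in S) p].

Definition contractible_subgraph (S : {set vertex L}) : Prop :=
  [/\ S != set0,
      forall u v, u \in S -> v \in S -> exists p, walk_in S u p v
    & forall u p, walk_in S u p u -> contractible u p].

(* A closed path in the dual graph is a cyclic sequence of darts: the dart d
   stands for crossing the edge of d from the face on its left to the face on
   its right. *)
Definition dual_step (d d' : dart) : bool := face (flip d) == face d'.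

Definition simple_dual_cycle (p : seq dart) : bool :=
  [&& p != [::], path.cycle dual_step p & uniq (map face p)].

(* For d \in p, the path p leaves the face [face d] through d, after entering
   it through the following dart of that face. *)
Definition entry (p : seq dart) (d : dart) : dart := flip (prev p d).

(* p and q pass through the face [face a] = [face b], which they leave
   through a and b; their four ends alternate around the face. *)
Definition transversal_at (p q : seq dart) (a b : dart) : bool :=
  let pos := findex face_next (entry p a) in
  (pos (entry q b) < pos a)%N != (pos b < pos a)%N.

Definition meet_once (p q : seq dart) : Prop :=
  exists a b, [/\ a \in p, b \in q, face a = face b, transversal_at p q a b
    & forall a' b', a' \in p -> b' \in q -> face a' = face b' ->
        a' = a /\ b' = b].

Definition disjoint_cycles (p q : seq dart) : Prop :=
  forall a b, a \in p -> b \in q -> face a != face b.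

(* The 2n curves: (i, false) indexes p_x^i and (i, true) indexes p_y^i. *)
Definition curve (n : nat) : finType := ('I_n * bool)%type.

Definition xc n (i : 'I_n) : curve n := (i, false).
Definition yc n (i : 'I_n) : curve n := (i, true).

Definition consecutive n (k l : curve n) : Prop :=
  (exists i, k = xc i /\ l = yc i) \/
  (exists i j : 'I_n, j = i.+1 :> nat /\ k = yc i /\ l = xc j).

Section Cut.
Variables (n : nat) (c : curve n -> seq dart).

Definition crossed : {set edge L} := [set e | [exists k, e \in map fst (c k)]].
Definition visited : {set {set dart}} :=
  [set f | [exists k, f \in map face (c k)]].

(* The complement of the curves retracts onto the cell complex made of all the
   vertices, the edges that are not crossed and the faces that are not visited.
   The complement is a disc iff this complex is connected and has Euler
   characteristic 1. *)
Definition cut_is_disc : Prop :=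
  (forall u v : vertex L,
     exists p, walk u p v /\ (forall d, d \in p -> d.1 \notin crossed)) /\
  (#|vertex L| + #|faces :\: visited| = #|~: crossed| + 1)%N.

Record loop_system : Prop := LoopSystem {
  loop_simple : forall k, simple_dual_cycle (c k);
  loop_cross1 : uniq [seq d.1 | k <- enum (curve n), d <- c k];
  loop_meet : forall k l, consecutive k l -> meet_once (c k) (c l);
  loop_disjoint : forall k l, k != l -> ~ consecutive k l ->
    ~ consecutive l k -> disjoint_cycles (c k) (c l);
  loop_disc : cut_is_disc
}.

End Cut.
End Graph.

Section Connections.
Variables (gT : finGroupType) (L : embedded_graph).

Definition connection := edge L -> gT.

Definition transport (phi : connection) (d : dart L) : gT :=
  if d.2 then phi d.1 else ((phi d.1)^-1)%g.

(* The last edge contributes the leftmost factor. *)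
Definition holonomy (phi : connection) (p : seq (dart L)) : gT :=
  (\prod_(d <- rev p) transport phi d)%g.

(* A label gamma sends [xc i] to x_i and [yc i] to y_i. *)
Definition label (n : nat) : finType := {ffun curve n -> gT}.

Definition labels n : {set label n} :=
  [set gamma : label n |
     [forall i, gamma (xc i) * gamma (yc i) == gamma (yc i) * gamma (xc i)] &&
     [forall i : 'I_n, forall j : 'I_n, (j == i.+1 :> nat) ==>
        (gamma (yc i) * gamma (xc j) == gamma (xc j) * gamma (yc i))]]%g.

Definition conj_label n (h : gT) (gamma : label n) : label n :=
  [ffun k => h * gamma k * h^-1]%g.

Definition label_class n (gamma : label n) : {set label n} :=
  [set conj_label h gamma | h : gT].

Definition label_classes n : {set {set label n}} :=
  [set label_class gamma | gamma in labels n].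

Definition label_centralizer n (gamma : label n) : {group gT} :=
  'C([set gamma k | k : curve n])%G.

(* The path c k crosses the edge e with e pointing to the left of the path
   when (e, true) \in c k: (direction of the path, direction of e) is then a
   positively oriented frame and the crossing counts as right-handed. *)
Definition label_connection n (c : curve n -> seq (dart L)) (gamma : label n)
    : connection := fun e =>
  if [pick k | (e, true) \in c k] is Some k then gamma k
  else if [pick k | (e, false) \in c k] is Some k then ((gamma k)^-1)%g
  else 1%g.

End Connections.

Section TensorProduct.
Variables (C : numClosedFieldType) (V : finType) (d : V -> nat).

(* The Hilbert space at v is C^(d v), with its standard orthonormal basis, and
   the tensor product over W : {set V} has the product basis. Vectors are
   columns and operators act on the left. *)
Definition config : finType := {dffun forall v : V, 'I_(d v)}.
Definition subconfig (W : {set V}) : finType :=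
  {dffun forall w : {v | v \in W}, 'I_(d (val w))}.

Definition basis_config (s : 'I_#|config|) : {dffun forall v : V, 'I_(d v)} :=
  enum_val s.

Definition restrict (W : {set V}) (s : 'I_#|config|) : 'I_#|subconfig W| :=
  enum_rank ([ffun w => basis_config s (val w)] : subconfig W).

Definition tensor_op (A : forall v, 'M[C]_(d v)) : 'M[C]_#|config| :=
  \matrix_(s, t) \prod_v A v (basis_config s v) (basis_config t v).

(* k tensored with the identity of the factors outside W. *)
Definition extend_op (W : {set V}) (k : 'M[C]_#|subconfig W|)
    : 'M[C]_#|config| :=
  \matrix_(s, t)
    (k (restrict W s) (restrict W t)
     *+ [forall v, (v \notin W) ==> (basis_config s v == basis_config t v)]).

Definition acts_on (W : {set V}) (h : 'M[C]_#|config|) : Prop :=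
  exists k : 'M[C]_#|subconfig W|, h = extend_op k.

End TensorProduct.

Section Matter.
Variables (C : numClosedFieldType) (gT : finGroupType) (L : embedded_graph).
Variables (d : vertex L -> nat).
Variable U : forall v, mx_representation C [set: gT] (d v).

Notation matter := #|config d|.

Definition unitary_reps : Prop := forall v g, U v g \is unitarymx.

Definition symmetry (g : gT) : 'M[C]_matter := tensor_op (fun v => U v g).

(* Each term h v acts on the subgraph Gamma_v induced on S v. *)
Record local_symmetric (S : vertex L -> {set vertex L})
    (h : vertex L -> 'M[C]_matter) : Prop := LocalSymmetric {
  term_subgraph : forall v, contractible_subgraph (S v);
  term_support : forall v, acts_on (S v) (h v);
  term_hermitian : forall v, h v \is hermsymmx;
  term_symmetric : forall v g, h v *m symmetry g = symmetry g *m h v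
}.

(* A base vertex b v of Gamma_v and paths pth v w in Gamma_v from b v to w. *)
Definition based_paths (S : vertex L -> {set vertex L})
    (b : vertex L -> vertex L) (pth : vertex L -> vertex L -> seq (dart L))
    : Prop :=
  forall v, b v \in S v /\
    (forall w, w \in S v -> walk_in (S v) (b v) (pth v w) w).

Definition twist_op (S : {set vertex L}) (pth : vertex L -> seq (dart L))
    (phi : connection gT L) : 'M[C]_matter :=
  tensor_op (fun w => if w \in S then U w (holonomy phi (pth w)) else 1%:M).

Definition twist (S : {set vertex L}) (pth : vertex L -> seq (dart L))
    (phi : connection gT L) (h : 'M[C]_matter) : 'M[C]_matter :=
  twist_op S pth phi *m h *m (twist_op S pth phi)^t*.

Definition twisted_hamiltonian (S : vertex L -> {set vertex L})
    (pth : vertex L -> vertex L -> seq (dart L)) (h : vertex L -> 'M[C]_matter)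
    (phi : connection gT L) : 'M[C]_matter :=
  \sum_(v : vertex L) twist (S v) (pth v) phi (h v).

(* The edge space, the tensor product over the edges of C[G], has the
   orthonormal basis |g>, g : {ffun edge L -> gT}. *)
Notation edges := #|{ffun edge L -> gT}|.

Definition edge_ket (g : {ffun edge L -> gT}) : 'cV[C]_edges :=
  delta_mx (enum_rank g) 0.

Definition gauging_map (phi : connection gT L)
    : 'M[C]_(matter * edges, matter) :=
  (#|[set: gT]|%:R ^+ #|vertex L|)^-1 *:
  \sum_(g : {ffun vertex L -> gT})
    castmx (erefl, muln1 matter)
      (tensor_op (fun v => U v (g v)) *t
       edge_ket [ffun e => g (head e) * phi e * (g (tail e))^-1]%g).

(* The matrix M in the set of representatives r c, c a class of labels. *)
Definition overlap_matrix n (c : curve n -> seq (dart L))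
    (lam : label gT n -> 'cV[C]_matter) (r : {set label gT n} -> label gT n)
    : 'M[C]_#|label_classes gT n| :=
  \matrix_(i, j)
    let gamma' := r (enum_val i) in
    let gamma := r (enum_val j) in
    ((lam gamma')^t* *m (gauging_map (label_connection c gamma'))^t*
     *m gauging_map (label_connection c gamma) *m lam gamma) 0 0.

(* psi spans a nontrivial one-dimensional representation of H under the
   physical symmetry. *)
Definition transforms_nontrivially (H : {group gT}) (psi : 'cV[C]_matter)
    : Prop :=
  exists chi : mx_representation C H 1,
    (forall g, g \in H -> symmetry g *m psi = psi *m chi g) /\
    (exists2 g, g \in H & chi g != 1%:M).

End Matter.

Definition representatives (gT : finGroupType) n
    (r : {set label gT n} -> label gT n) : Prop :=
  forall cl, cl \in label_classes gT n -> r cl \in cl.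

(* psi is a normalized ground state of the Hermitian operator H, with energy
   E0, and spans the ground space. *)
Definition unique_ground_state (C : numClosedFieldType) (m : nat)
    (H : 'M[C]_m) (E0 : C) (psi : 'cV[C]_m) : Prop :=
  [/\ H *m psi = E0 *: psi,
      psi^t* *m psi = 1%:M,
      forall (a : C) (w : 'cV[C]_m), w != 0 -> H *m w = a *: w -> E0 <= a
    & forall w : 'cV[C]_m, H *m w = E0 *: w -> exists a, w = a *: psi].

(* Main.v *)
Require Import Defs.

Set Implicit Arguments.
Unset Strict Implicit.
Unset Printing Implicit Defensive.

Import Order.TTheory GRing.Theory Num.Theory.
Local Open Scope ring_scope.
Local Open Scope sesquilinear_scope.

(* The edge registers of G_phi record the gauge transforms of phi, so that
   G_phi'^* G_phi is, up to a positive factor, the sum of the operators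
   (x)_v U_v(k_v) over the gauge transformations k taking phi to phi'. For the
   connections of two labels such a k is constant, because the graph cut along
   the curves is connected and both connections are trivial on it; it then
   conjugates one label into the other. This kills the off-diagonal entries and
   makes the diagonal entry a sum over the centralizer of
   <lambda, U(g) lambda>. The symmetry g intertwines the twisted Hamiltonians of
   gamma and of its conjugate by g, so by uniqueness it maps one ground state to
   the other up to a phase: the centralizer acts by a linear character, whose
   sum vanishes exactly when it is nontrivial. *)

(** * Products and adjoints of tensor product operators *)

Lemma sum_prod_dffun (R : comPzRingType) (I : finType) (T : I -> finType)
    (F : forall i, T i -> R) :
  \sum_(f : {dffun forall i, T i}) \prod_i F i (f i) =
  \prod_i \sum_(j : T i) F i j.
Proof.
rewrite (reindex (@dffun_of_fprod I T)) /=; last first.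
  exact/onW_bij/dffun_of_fprod_bij.
pose P i := [ffun j => F i j].
transitivity (\sum_(t : fprod T) \prod_(i in I) P i (t i)).
  by apply: eq_bigr => t _; apply: eq_bigr => i _; rewrite !ffunE.
(* The sum now runs over functions into the tagged union whose value at [i] has tag [i], where
   distributivity applies; the default 0 of [untag] is never reached. *)
rewrite big_fprod -(bigA_distr_big_dep _ (fun i u => untag 0 (P i) u)).
apply: eq_bigr => i _; transitivity (\sum_j P i j); last first.
  by apply: eq_bigr => j _; rewrite ffunE.
exact/esym/(big_tag (fun i j => P i j)).
Qed.

Lemma adjmx_mul (C : numClosedFieldType) m n p (A : 'M[C]_(m, n))
    (B : 'M[C]_(n, p)) : (A *m B)^t* = B^t* *m A^t*.
Proof. by rewrite trmx_mul map_mxM. Qed.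

Lemma adjmxZ (C : numClosedFieldType) m n (a : C) (A : 'M[C]_(m, n)) :
  (a *: A)^t* = a^* *: A^t*.
Proof. by apply/matrixP=> i j; rewrite !mxE rmorphM. Qed.

Section TensorOp.
Variables (C : numClosedFieldType) (V : finType) (d : V -> nat).
Implicit Types A B : forall v, 'M[C]_(d v).

Lemma eq_tensor_op A B : (forall v, A v = B v) -> tensor_op A = tensor_op B.
Proof.
move=> AB; apply/matrixP=> s t; rewrite !mxE.
by apply: eq_bigr => v _; rewrite AB.
Qed.

(** The sum over intermediate configurations splits into one sum per vertex, each an entry of
    [A v *m B v]. *)
Lemma tensor_opM A B :
  tensor_op A *m tensor_op B = tensor_op (fun v => A v *m B v).
Proof.
apply/matrixP=> s t; rewrite !mxE.
rewrite (reindex (@enum_rank (config d))) /=; last exact/onW_bij/enum_rank_bij.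
transitivity (\sum_(f : config d) \prod_v
    (A v (basis_config s v) (f v) * B v (f v) (basis_config t v))).
  apply: eq_bigr => f _; rewrite !mxE -big_split /=.
  by apply: eq_bigr => v _; rewrite /basis_config enum_rankK.
rewrite (sum_prod_dffun
  (fun v j => A v (basis_config s v) j * B v j (basis_config t v))).
by apply: eq_bigr => v _; rewrite mxE.
Qed.

Lemma tensor_op1 : tensor_op (fun v => 1%:M : 'M[C]_(d v)) = 1%:M.
Proof.
apply/matrixP=> s t; rewrite !mxE; case: eqVneq => [->|neq_st].
  by rewrite big1 // => v _; rewrite mxE eqxx.
have [v neq_v] : exists v, basis_config s v != basis_config t v.
  apply/existsP; rewrite -negb_forall; apply: contra neq_st => /forallP eq_st.
  by apply/eqP/enum_val_inj/ffunP => v; apply/eqP/eq_st.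
by rewrite (bigD1 v) //= mxE (negPf neq_v) mul0r.
Qed.

Lemma tensor_op_adj A : (tensor_op A)^t* = tensor_op (fun v => (A v)^t*).
Proof.
apply/matrixP=> s t; rewrite !mxE rmorph_prod.
by apply: eq_bigr => v _; rewrite !mxE.
Qed.

End TensorOp.

(** * Gauge transformations and Gram matrices of gauging maps *)

Section Gauge.
Variables (C : numClosedFieldType) (gT : finGroupType) (L : embedded_graph).
Variables (d : vertex L -> nat).
Variable U : forall v, mx_representation C [set: gT] (d v).
Hypothesis U_unitary : unitary_reps U.
Implicit Types (k : vertex L -> gT) (phi : connection gT L).

Definition gauge_op k : 'M[C]_#|config d| := tensor_op (fun v => U v (k v)).

Lemma eq_gauge_op k k' : k =1 k' -> gauge_op k = gauge_op k'.
Proof. by move=> kk'; apply: eq_tensor_op => v; rewrite kk'. Qed.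

Lemma gauge_op1 : gauge_op (fun=> 1%g) = 1%:M.
Proof. by rewrite -tensor_op1; apply: eq_tensor_op => v; rewrite repr_mx1. Qed.

Lemma gauge_opM k k' :
  gauge_op k *m gauge_op k' = gauge_op (fun v => k v * k' v)%g.
Proof.
by rewrite tensor_opM; apply: eq_tensor_op => v; rewrite repr_mxM ?inE.
Qed.

Lemma gauge_op_adj k : (gauge_op k)^t* = gauge_op (fun v => (k v)^-1)%g.
Proof.
rewrite tensor_op_adj; apply: eq_tensor_op => v.
by rewrite repr_mxV ?inE // invmx_unitary.
Qed.

Lemma symmetry1 : symmetry U 1 = 1%:M.
Proof. exact: gauge_op1. Qed.

Lemma symmetryM g g' : symmetry U g *m symmetry U g' = symmetry U (g * g').
Proof. exact: gauge_opM. Qed.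

Lemma symmetry_adj g : (symmetry U g)^t* = symmetry U g^-1.
Proof. exact: gauge_op_adj. Qed.

Lemma edge_ket_dot (f f' : {ffun edge L -> gT}) :
  (edge_ket C f)^t* *m edge_ket C f' = (f == f')%:R%:M.
Proof.
rewrite /edge_ket trmx_delta map_delta_mx mul_delta_mx_cond.
rewrite (inj_eq enum_rank_inj); apply/matrixP=> i j; rewrite !ord1 !mxE.
by case: eqP => _; rewrite !mxE ?eqxx.
Qed.

(** Tensoring with the column [edge_ket] produces [m * 1] columns, which [gauging_map] casts back to
    [m]; this moves the cast out of inner products. *)
Lemma castmx_gram m n n' (E : n = n') (X Y : 'M[C]_(m, n)) :
  (castmx (erefl, E) X)^t* *m castmx (erefl, E) Y =
  castmx (E, E) (X^t* *m Y).
Proof. by case: n' / E. Qed.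

(* The edge registers record the gauge transformed connections exactly, so only
   the pairs of gauge transformations giving the same one contribute. *)
Lemma gauging_map_gram phi phi' :
  (gauging_map U phi')^t* *m gauging_map U phi =
  (#|[set: gT]|%:R ^+ #|vertex L|)^-1 *:
  \sum_(k : {ffun vertex L -> gT} |
     [forall e, phi' e == k (head e) * phi e * (k (tail e))^-1]%g)
    gauge_op k.
Proof.
pose N : C := #|[set: gT]|%:R ^+ #|vertex L|.
have N_neq0 : N != 0 by rewrite expf_neq0 // pnatr_eq0 -lt0n cardG_gt0.
have N_conj : (N^-1)^* = N^-1.
  by rewrite fmorphV rmorphXn rmorph_nat.
pose K g k : bool := [forall e, g (head e) * phi' e * (g (tail e))^-1 ==
   k (head e) * phi e * (k (tail e))^-1]%g.
have gramE (g k : {ffun vertex L -> gT}) :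
    (castmx (erefl, muln1 _) (gauge_op g *t edge_ket C
       [ffun e => g (head e) * phi' e * (g (tail e))^-1]%g))^t* *m
    castmx (erefl, muln1 _) (gauge_op k *t edge_ket C
       [ffun e => k (head e) * phi e * (k (tail e))^-1]%g) =
    gauge_op (fun v => (g v)^-1 * k v)%g *+ K g k.
  rewrite castmx_gram trmx_tens map_mxT tensmx_mul gauge_op_adj gauge_opM.
  rewrite edge_ket_dot tens_mx_scalar castmx_comp castmx_id scaler_nat.
  congr (_ *+ nat_of_bool _); apply/eqP/forallP => [/ffunP eq_e e|eq_e].
    by have := eq_e e; rewrite !ffunE => ->.
  by apply/ffunP => e; rewrite !ffunE; apply/eqP/eq_e.
rewrite /gauging_map -/N adjmxZ N_conj -scalemxAl -scalemxAr.
congr (_ *: _); rewrite [(\sum_g _)^T]linear_sum map_mx_sum mulmx_suml /=.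
(* Each term depends only on [g^-1 k], so the inner sum is the same for all [g]; the outer sum then
   contributes [N] and cancels one of the two factors [N^-1]. *)
transitivity (N^-1 *: \sum_(g : {ffun vertex L -> gT})
  \sum_(k : {ffun vertex L -> gT} |
     [forall e, phi' e == k (head e) * phi e * (k (tail e))^-1]%g)
    gauge_op k); last first.
  rewrite sumr_const card_ffun -scaler_nat scalerA natrX -(cardsT gT).
  by rewrite mulVf ?scale1r.
congr (_ *: _); apply: eq_bigr => g _.
rewrite mulmx_sumr.
under eq_bigr do rewrite gramE.
pose mul (x : {ffun vertex L -> gT}) (k : {ffun vertex L -> gT}) :=
  [ffun v => x v * k v]%g.
rewrite (reindex (mul g)) /=; last first.
  by exists (mul [ffun v => (g v)^-1]%g) => k _;
    apply/ffunP => v; rewrite !ffunE ?mulKg ?mulKVg.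
rewrite [RHS]big_mkcond; apply: eq_bigr => k _.
have -> : K g (mul g k) =
    [forall e, phi' e == k (head e) * phi e * (k (tail e))^-1]%g.
  apply: eq_forallb => e; rewrite !ffunE invMg -!mulgA (inj_eq (mulgI _)).
  by rewrite !mulgA (inj_eq (mulIg _)).
case: ifP => _ //; rewrite mulr1n.
by apply: eq_gauge_op => v; rewrite ffunE mulKg.
Qed.

End Gauge.

Lemma map_uniq_inj (T T' : eqType) (f : T -> T') (s : seq T) :
  uniq (map f s) -> {in s &, injective f}.
Proof.
elim: s => //= x s IHs /andP[fx /IHs inj] y z.
rewrite !inE => /predU1P[->|ys] /predU1P[->|zs] // fyz.
- by case/negP: fx; rewrite fyz map_f.
- by case/negP: fx; rewrite -fyz map_f.
- exact: inj.
Qed.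

(** * Conjugating a connection by a constant group element *)

Section Conjugation.
Variables (C : numClosedFieldType) (gT : finGroupType) (L : embedded_graph).
Variables (d : vertex L -> nat).
Variable U : forall v, mx_representation C [set: gT] (d v).
Hypothesis U_unitary : unitary_reps U.
Variables (g : gT) (phi phi' : connection gT L).
Hypothesis phi'E : forall e, phi' e = (g * phi e * g^-1)%g.

Lemma holonomy_conj p : holonomy phi' p = (g * holonomy phi p * g^-1)%g.
Proof.
rewrite /holonomy.
rewrite (big_morph (fun x => g * x * g^-1)%g (id1 := 1%g) (op1 := mulg)).
- apply: eq_bigr => -[e s] _; rewrite /transport /= phi'E; case: s => //.
  by rewrite !invMg invgK mulgA.
- by move=> x y; rewrite !mulgA mulgKV.
- by rewrite mulg1 mulgV.
Qed.

Lemma twist_op_conj S pth :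
  twist_op U S pth phi' =
  symmetry U g *m twist_op U S pth phi *m symmetry U g^-1.
Proof.
rewrite /twist_op /symmetry !tensor_opM; apply: eq_tensor_op => w.
case: ifP => _; first by rewrite holonomy_conj -!repr_mxM ?inE.
by rewrite mulmx1 -repr_mxM ?inE // mulgV repr_mx1.
Qed.

(** The new twist operator is the old one conjugated by [symmetry U g]; the inner symmetries meet
    [h], commute with it and cancel. *)
Lemma twist_conj S pth (h : 'M_#|config d|) :
  (forall k, h *m symmetry U k = symmetry U k *m h) ->
  symmetry U g *m twist U S pth phi h = twist U S pth phi' h *m symmetry U g.
Proof.
move=> h_sym; rewrite /twist twist_op_conj !adjmx_mul !symmetry_adj // invgK.
have symVK : symmetry U g^-1 *m symmetry U g = 1%:M.
  by rewrite symmetryM mulVg symmetry1.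
rewrite !mulmxA -[_ *m symmetry U g^-1 *m symmetry U g]mulmxA symVK mulmx1.
rewrite -[_ *m h *m symmetry U g]mulmxA h_sym mulmxA.
by rewrite -[_ *m symmetry U g^-1 *m symmetry U g]mulmxA symVK mulmx1.
Qed.

Lemma twisted_hamiltonian_conj S pth (h : vertex L -> 'M_#|config d|) :
  local_symmetric U S h ->
  symmetry U g *m twisted_hamiltonian U S pth h phi =
  twisted_hamiltonian U S pth h phi' *m symmetry U g.
Proof.
case=> _ _ _ h_sym; rewrite mulmx_sumr mulmx_suml.
by apply: eq_bigr => v _; apply: twist_conj.
Qed.

End Conjugation.

(** * Labels, their connections and the cut graph *)

Section LabelConnection.
Variables (gT : finGroupType) (L : embedded_graph) (n : nat).
Variable c : curve n -> seq (dart L).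
Implicit Types (gamma : label gT n).

Lemma conj_label1 gamma : conj_label 1 gamma = gamma.
Proof. by apply/ffunP => k; rewrite ffunE mul1g invg1 mulg1. Qed.

Lemma conj_labelM g h gamma :
  conj_label (g * h) gamma = conj_label g (conj_label h gamma).
Proof. by apply/ffunP => k; rewrite !ffunE invMg !mulgA. Qed.

Lemma conj_labelK g : cancel (@conj_label gT n g) (conj_label g^-1).
Proof. by move=> gamma; rewrite -conj_labelM mulVg conj_label1. Qed.

Lemma conj_label_in g gamma :
  gamma \in labels gT n -> conj_label g gamma \in labels gT n.
Proof.
have conjM x y : (g * x * g^-1 * (g * y * g^-1) = g * (x * y) * g^-1)%g.
  by rewrite !mulgA mulgKV.
rewrite !inE => /andP[/forallP xy /forallP yx]; apply/andP; split.
  by apply/forallP => i; rewrite !ffunE !conjM (eqP (xy i)).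
apply/forallP => i; apply/forallP => j; apply/implyP => ij.
have /forallP/(_ j)/implyP/(_ ij)/eqP yxE := yx i.
by rewrite !ffunE !conjM yxE.
Qed.

Lemma label_class_conj g gamma :
  label_class (conj_label g gamma) = label_class gamma.
Proof.
apply/setP => x; apply/imsetP/imsetP => -[h _ ->].
  by exists (h * g)%g; rewrite ?conj_labelM.
by exists (h * g^-1)%g; rewrite // -conj_labelM mulgKV.
Qed.

(** Shows that the index set of a diagonal overlap, a stabilizer under conjugation, is a group over
    which a character can be summed. *)
Lemma mem_label_centralizer g gamma :
  (g \in label_centralizer gamma) = (conj_label g gamma == gamma).
Proof.
apply/centP/eqP => [gC|/ffunP gC x /imsetP[k _ ->]].
  apply/ffunP => k; rewrite ffunE (gC (gamma k)) ?mulgK //.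
  exact: imset_f.
by have := gC k; rewrite ffunE => gk; rewrite /commute -{2}gk mulgKV.
Qed.

Lemma label_connection_conj g gamma e :
  label_connection c (conj_label g gamma) e =
  (g * label_connection c gamma e * g^-1)%g.
Proof.
rewrite /label_connection; case: pickP => [k _|_]; first by rewrite ffunE.
case: pickP => [k _|_]; first by rewrite ffunE !invMg invgK mulgA.
by rewrite mulg1 mulgV.
Qed.

Lemma label_connection_uncrossed gamma e :
  e \notin crossed c -> label_connection c gamma e = 1%g.
Proof.
rewrite inE => /existsPn e_nc; have nc s k : (e, s) \in c k = false.
  by apply: contraNF (e_nc k) => esk; apply/mapP; exists (e, s).
by rewrite /label_connection; do 2!(case: pickP => [k|_]; first by rewrite nc).
Qed.

Hypothesis cL : loop_system c.

Lemma loop_nonempty k : exists dt, dt \in c k.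
Proof.
have /and3P[+ _ _] := loop_simple cL k.
by case: (c k) => // dt p _; exists dt; rewrite mem_head.
Qed.

Lemma loop_cross_inj e s s' k k' :
  (e, s) \in c k -> (e, s') \in c k' -> s = s' /\ k = k'.
Proof.
move=> es es'; have := loop_cross1 cL.
(* The duplicate-free list of crossed edges is the image of the list of pairs (curve, dart), so the
   edge determines both the curve and the direction. *)
rewrite -(map_allpairs (fun kd : curve n * dart L => kd.2.1) pair).
move/map_uniq_inj => inj.
have memP s0 l : (e, s0) \in c l ->
    (l, (e, s0)) \in [seq (l, dt) | l <- enum (curve n), dt <- c l].
  by move=> el; apply: allpairs_f_dep; rewrite ?mem_enum.
by have [-> ->] := inj _ _ (memP _ _ es) (memP _ _ es') erefl.
Qed.

Lemma label_connection_crossed e s k gamma :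
  (e, s) \in c k ->
  label_connection c gamma e = if s then gamma k else ((gamma k)^-1)%g.
Proof.
move=> esk; rewrite /label_connection; case: pickP => [k' ek'|nek].
  by have [-> ->] := loop_cross_inj esk ek'.
case: s esk => esk; first by have := nek k; rewrite esk.
case: pickP => [k' ek'|/(_ k)]; last by rewrite esk.
by have [_ ->] := loop_cross_inj esk ek'.
Qed.

(** On an uncrossed edge both connections are 1, so [k] takes equal values at its two ends;
    [loop_disc] joins any two vertices through such edges. *)
Lemma gauge_equivalent_const gamma gamma' (k : vertex L -> gT) :
  (forall e, label_connection c gamma' e =
     k (head e) * label_connection c gamma e * (k (tail e))^-1)%g ->
  forall u v, k u = k v.
Proof.
move=> gE u v; have [conn _] := loop_disc cL; have [p [+ p_nc]] := conn u v.
elim: p u p_nc => [|dt p IHp] u p_nc /=; first by move/eqP->.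
case/andP => /eqP <- /(IHp _ _) <-; last first.
  by move=> dt' dt'p; apply: p_nc; rewrite inE dt'p orbT.
have := gE dt.1; rewrite !label_connection_uncrossed ?p_nc ?mem_head //.
rewrite mulg1 => /esym/eqP; rewrite -eq_mulgV1 => /eqP.
by rewrite /src /tgt; case: ifP.
Qed.

(** A label can be read off its connection: every curve crosses some edge, which carries the entry
    of that curve or its inverse. *)
Lemma label_connection_conjP g gamma gamma' :
  reflect (forall e, label_connection c gamma' e =
             g * label_connection c gamma e * g^-1)%g
          (conj_label g gamma == gamma').
Proof.
apply: (iffP eqP) => [<- e|gE]; first exact: label_connection_conj.
apply/ffunP => k; have [[e s] esk] := loop_nonempty k.
have := gE e; rewrite -label_connection_conj !(label_connection_crossed _ esk).
by case: (s) => [//|/invg_inj].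
Qed.

End LabelConnection.

(** Translation by [g] gives [chi g *m sum = sum], so a [chi g] other than 1 kills the sum, the
    matrices being scalars. If [chi] is trivial, the sum is the order of [G], which is nonzero. *)
Lemma sum_repr1_eq0 (C : numClosedFieldType) (gT : finGroupType)
    (G : {group gT}) (chi : mx_representation C G 1) :
  \sum_(g in G) chi g = 0 <-> exists2 g, g \in G & chi g != 1%:M.
Proof.
split=> [sum0|[g Gg chig]].
  apply/exists_inP; rewrite -[X in is_true X]negbK negb_exists_in.
  apply/forall_inP => chi1; move/eqP: sum0; apply/negP.
  rewrite (eq_bigr (fun=> 1%:M)) => [|g /chi1 /negPn/eqP //].
  rewrite sumr_const -scaler_nat scaler_eq0 negb_or pnatr_eq0 -lt0n cardG_gt0.
  exact: matrix_nonzero1.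
have : (chi g - 1%:M) *m \sum_(x in G) chi x = 0.
  rewrite mulmxBl mul1mx; apply/eqP; rewrite subr_eq0 mulmx_sumr.
  rewrite [X in _ == X](reindex_inj (mulgI g)) /=; apply/eqP/eq_big => x.
    by rewrite groupMl.
  by move=> Gx; rewrite repr_mxM.
rewrite [chi g - _]mx11_scalar mul_scalar_mx => /eqP.
rewrite scaler_eq0 => /orP[|/eqP //] /eqP chi0; case/negP: chig.
by rewrite -subr_eq0 [_ - _]mx11_scalar chi0 raddf0.
Qed.

(** * Overlaps of the gauged ground states *)

Section Overlap.
Variables (C : numClosedFieldType) (gT : finGroupType) (n : nat).
Variables (L : embedded_graph) (c : curve n -> seq (dart L)).
Variables (d : vertex L -> nat).
Variable U : forall v, mx_representation C [set: gT] (d v).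
Hypotheses (n_gt0 : (0 < n)%N) (cL : loop_system c).
Hypothesis U_unitary : unitary_reps U.

(* Off the curves the connections are trivial and the cut graph is connected,
   so a gauge transformation between two of them is constant. *)
Lemma gauging_map_gram_label gamma gamma' :
  (gauging_map U (label_connection c gamma'))^t* *m
    gauging_map U (label_connection c gamma) =
  (#|[set: gT]|%:R ^+ #|vertex L|)^-1 *:
  \sum_(k : gT | conj_label k gamma == gamma') symmetry U k.
Proof.
rewrite gauging_map_gram //; congr (_ *: _).
(* Positive [n] provides a curve, hence a crossed edge [e]; its tail is the vertex where a constant
   gauge transformation is evaluated to recover the group element. *)
have [[e s] _] := loop_nonempty cL (xc (Ordinal n_gt0)).
rewrite (reindex_onto (fun k : gT => [ffun=> k]) (fun k => k (tail e))) /=.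
  apply: eq_big => k.
    rewrite ffunE eqxx andbT.
    apply/forallP/(label_connection_conjP cL) => kE e'.
      by have /eqP := kE e'; rewrite !ffunE.
    by rewrite !ffunE; apply/eqP.
  by move=> _; apply: eq_gauge_op => v; rewrite ffunE.
move=> k /forallP kE; apply/ffunP => v; rewrite ffunE.
by apply: (gauge_equivalent_const cL (gamma := gamma) (gamma' := gamma')) => e';
  apply/eqP.
Qed.

Variables (S : vertex L -> {set vertex L}) (h : vertex L -> 'M[C]_#|config d|).
Hypothesis h_local : local_symmetric U S h.
Variable pth : vertex L -> vertex L -> seq (dart L).
Variables (lambda0 : C) (lam : label gT n -> 'cV[C]_#|config d|).
Hypothesis lamP : forall gamma : label gT n, gamma \in labels gT n ->
  unique_ground_state (twisted_hamiltonian U S pth h (label_connection c gamma))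
    lambda0 (lam gamma).

Lemma ground_state_conj g gamma : gamma \in labels gT n ->
  exists2 a, a^* * a = 1 &
    symmetry U g *m lam gamma = a *: lam (conj_label g gamma).
Proof.
move=> gammaL; have [Hlam lam1 _ _] := lamP gammaL.
have [_ lam1' _ lam_uniq] := lamP (conj_label_in g gammaL).
have [|a Uga] := lam_uniq (symmetry U g *m lam gamma).
  rewrite mulmxA -(twisted_hamiltonian_conj U_unitary
    (label_connection_conj c g gamma) _ h_local).
  by rewrite -mulmxA Hlam scalemxAr.
(* Both ground states are normalized and the symmetry is unitary, so comparing squared norms yields
   [a^* * a = 1]. *)
exists a => //; have := congr1 (fun w => w^t* *m w) Uga.
rewrite adjmx_mul symmetry_adj // -mulmxA [X in _ *m X]mulmxA symmetryM mulVg.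
rewrite symmetry1 mul1mx lam1 adjmxZ -scalemxAl -scalemxAr lam1'.
by rewrite scalerA => /matrixP/(_ 0 0); rewrite !mxE mulr1 => <-.
Qed.

Lemma ground_state_character gamma : gamma \in labels gT n ->
  exists chi : mx_representation C (label_centralizer gamma) 1,
    forall g, g \in label_centralizer gamma ->
      symmetry U g *m lam gamma = lam gamma *m chi g.
Proof.
move=> gammaL; have [_ lam1 _ _] := lamP gammaL.
(* By normalization this expectation value is the phase by which a centralizer element [g]
   multiplies [lam gamma]. *)
pose chi g := (lam gamma)^t* *m symmetry U g *m lam gamma.
have chiE g : g \in label_centralizer gamma ->
    symmetry U g *m lam gamma = lam gamma *m chi g.
  rewrite mem_label_centralizer => /eqP gC.
  have [a _] := ground_state_conj g gammaL; rewrite gC => Ug.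
  by rewrite /chi -mulmxA Ug -scalemxAr lam1 -scalemxAr mulmx1.
have chi_repr : mx_repr (label_centralizer gamma) chi.
  split=> [|x y Cx Cy]; first by rewrite /chi symmetry1 mulmx1.
  by rewrite {1}/chi -symmetryM -!mulmxA chiE // /chi !mulmxA.
by exists (MxRepresentation chi_repr).
Qed.

Definition overlap gamma' gamma : C :=
  ((lam gamma')^t* *m (gauging_map U (label_connection c gamma'))^t*
   *m gauging_map U (label_connection c gamma) *m lam gamma) 0 0.

Lemma overlapE gamma' gamma :
  overlap gamma' gamma = (#|[set: gT]|%:R ^+ #|vertex L|)^-1 *
  (\sum_(k : gT | conj_label k gamma == gamma')
      (lam gamma')^t* *m symmetry U k *m lam gamma) 0 0.
Proof.
rewrite /overlap -[_ *m _ *m gauging_map _ _]mulmxA gauging_map_gram_label.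
by rewrite -scalemxAr -scalemxAl mxE mulmx_sumr mulmx_suml.
Qed.

Lemma overlap_neq_class gamma' gamma :
  label_class gamma' != label_class gamma -> overlap gamma' gamma = 0.
Proof.
move=> neq; rewrite overlapE big_pred0 ?mxE ?mulr0 // => k.
by apply: contraNF neq => /eqP <-; rewrite label_class_conj.
Qed.

(** Conjugation by [g] matches the two stabilizers, and [symmetry U g] carries one ground state to
    the other up to a phase that cancels between bra and ket. *)
Lemma overlap_conj g gamma : gamma \in labels gT n ->
  overlap (conj_label g gamma) (conj_label g gamma) = overlap gamma gamma.
Proof.
move=> gammaL; rewrite !overlapE; congr (_ * _).
have [a a1 Uga] := ground_state_conj g gammaL.
rewrite (reindex_inj (conjg_inj g^-1%g)) /=; congr (fun_of_matrix _ _ _).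
have conjVg k : (k ^ g^-1 = g * k * g^-1)%g by rewrite conjgE invgK mulgA.
apply: eq_big => k.
  rewrite conjVg -conj_labelM mulgKV conj_labelM.
  by rewrite (inj_eq (can_inj (@conj_labelK _ _ g))).
(* Inserting [a^* * a = 1] lets each copy of the conjugate ground state absorb a phase and become
   [symmetry U g *m lam gamma]. *)
move=> _; rewrite -[LHS]scale1r -a1 -scalerA.
transitivity ((a *: lam (conj_label g gamma))^t* *m symmetry U (k ^ g^-1) *m
    (a *: lam (conj_label g gamma))).
  by rewrite adjmxZ -!scalemxAl -scalemxAr.
rewrite -Uga adjmx_mul symmetry_adj // -!mulmxA; congr (_ *m _).
by rewrite !mulmxA !symmetryM conjVg !mulgA mulVg mul1g mulgKV.
Qed.

Lemma overlap_diag_eq0 gamma : gamma \in labels gT n ->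
  overlap gamma gamma = 0 <->
  transforms_nontrivially U (label_centralizer gamma) (lam gamma).
Proof.
move=> gammaL; have [_ lam1 _ _] := lamP gammaL.
(* Stated for an arbitrary [chi], so that it serves both the character built from the ground state
   and the one supplied by [transforms_nontrivially]. *)
have overlap_chi (chi : mx_representation C (label_centralizer gamma) 1) :
    (forall g, g \in label_centralizer gamma ->
       symmetry U g *m lam gamma = lam gamma *m chi g) ->
    overlap gamma gamma = 0 <-> \sum_(g in label_centralizer gamma) chi g = 0.
  move=> chiE; rewrite overlapE (eq_big (mem (label_centralizer gamma)) chi).
  - split=> [/eqP|->]; last by rewrite mxE mulr0.
    rewrite mulf_eq0 invr_eq0 expf_eq0 pnatr_eq0 eqn0Ngt cardG_gt0 andbF.
    move/eqP.
    by rewrite [X in _ -> X = _]mx11_scalar => ->; rewrite raddf0.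
  - by move=> g; rewrite /= mem_label_centralizer.
  - move=> g; rewrite -mem_label_centralizer => Cg.
    by rewrite -mulmxA chiE // mulmxA lam1 mul1mx.
split=> [|[chi [chiE chi_nt]]]; last exact/(overlap_chi _ chiE)/sum_repr1_eq0.
have [chi chiE] := ground_state_character gammaL.
by move/(overlap_chi _ chiE)/sum_repr1_eq0 => chi_nt; exists chi.
Qed.

End Overlap.

Theorem proposition11 (R : realType) (gT : finGroupType) (n : nat)
  (L : embedded_graph) (n_ge1 : (1 <= n)%N)
  (L_connected : connected_graph L) (L_genus : has_genus L n)
  (c : curve n -> seq (dart L)) (c_loops : loop_system c)
  (d : vertex L -> nat)
  (U : forall v : vertex L, mx_representation R[i] [set: gT] (d v))
  (U_unitary : unitary_reps U)
  (S : vertex L -> {set vertex L}) (h : vertex L -> 'M[R[i]]_#|config d|)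
  (h_local : local_symmetric U S h)
  (b : vertex L -> vertex L) (pth : vertex L -> vertex L -> seq (dart L))
  (pthP : based_paths S b pth)
  (lambda0 : R[i]) (lam : label gT n -> 'cV[R[i]]_#|config d|)
  (lamP : forall gamma : label gT n, gamma \in labels gT n ->
     unique_ground_state
       (twisted_hamiltonian U S pth h (label_connection c gamma))
       lambda0 (lam gamma)) :
  [/\ forall r : {set label gT n} -> label gT n, representatives r ->
        is_diag_mx (overlap_matrix U c lam r),
      forall r r' : {set label gT n} -> label gT n,
        representatives r -> representatives r' ->
        overlap_matrix U c lam r = overlap_matrix U c lam r'
    & forall r : {set label gT n} -> label gT n, representatives r ->
        forall i : 'I_#|label_classes gT n|,
        overlap_matrix U c lam r i i = 0 <->
        transforms_nontrivially U (label_centralizer (r (enum_val i)))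
          (lam (r (enum_val i)))].
Proof.
have clsP (i : 'I_#|label_classes gT n|) :
    exists2 gamma, gamma \in labels gT n & enum_val i = label_class gamma.
  exact/imsetP/enum_valP.
have reprP r : representatives r -> forall i : 'I_#|label_classes gT n|,
    r (enum_val i) \in labels gT n /\ label_class (r (enum_val i)) = enum_val i.
  move=> rP i; have := rP _ (enum_valP i); have [gamma gammaL ->] := clsP i.
  by case/imsetP => g _ ->; rewrite conj_label_in ?label_class_conj.
have off_diag r : representatives r -> forall i j, i != j ->
    overlap_matrix U c lam r i j = 0.
  move=> rP i j neq_ij; rewrite mxE.
  apply: (overlap_neq_class n_ge1 c_loops U_unitary).
  have [_ ->] := reprP r rP i; have [_ ->] := reprP r rP j.
  by rewrite (inj_eq enum_val_inj).
split=> [r rP|r r' rP r'P|r rP i].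
- by apply/is_diag_mxP => i j neq_ij; apply: off_diag.
- apply/matrixP => i j.
  have [<-|neq_ij] := eqVneq i j; last by rewrite !off_diag.
  have [rL r_cls] := reprP r rP i; rewrite !mxE.
  (* Both choices lie in the same class, so [r'] picks a conjugate of the label picked by [r], and
     [overlap_conj] applies. *)
  have := r'P _ (enum_valP i); rewrite -{2}r_cls => /imsetP[g _ ->].
  exact/esym/(overlap_conj n_ge1 c_loops U_unitary h_local lamP).
- have [rL _] := reprP r rP i; rewrite mxE.
  exact: (overlap_diag_eq0 n_ge1 c_loops U_unitary h_local lamP).
Qed.
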